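(* Let $m>1$ and $n>1$ be integers and let $G_{mn}=\langle a,b;\ [a^m,b^n]=1\rangle$. Then any normal automorphism of the group $G_{mn}$ is inner.
   Context: $\langle a,b;\ [a^m,b^n]=1\rangle$ denotes the group with generators $a,b$ and the single defining relation $[a^m,b^n]=1$, where $[x,y]=x^{-1}y^{-1}xy$ is the commutator. An automorphism $\varphi$ of a group $G$ is called normal if it maps every normal subgroup of $G$ onto itself, i.e. $N\varphi=N$ for every normal subgroup $N$ of $G$. *)

(* Defs.v *)
From HB Require Import structures.
From mathcomp Require Import all_boot.
From mathcomp Require Import boolp classical_sets.

Set Implicit Arguments.
Unset Strict Implicit.
Unset Printing Implicit Defensive.

Local Open Scope quotient_scope.
Local Open Scope group_scope.
Local Open Scope classical_set_scope.

Section Presentation.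
Variable X : choiceType.

(* The letter (x, false) stands for the generator x, (x, true) for x^-1. *)
Definition word := seq (X * bool).

Definition flip (l : X * bool) : X * bool := (l.1, ~~ l.2).

Definition word_inv (w : word) : word := rev (map flip w).

Definition word_comm (u v : word) : word :=
  word_inv u ++ word_inv v ++ u ++ v.

Variable R : set word.

(* Two words define the same element of < X ; r = 1, r in R > iff one is      *)
(* obtained from the other by finitely many insertions and deletions of       *)
(* trivial pairs l l^-1 and of relators.                                      *)
Inductive word_eqv : word -> word -> Prop :=
| word_eqv_refl w : word_eqv w w
| word_eqv_sym u v : word_eqv u v -> word_eqv v u
| word_eqv_trans u v w : word_eqv u v -> word_eqv v w -> word_eqv u w
| word_eqv_cancel u v l : word_eqv (u ++ l :: flip l :: v) (u ++ v)
| word_eqv_relator u v r : R r -> word_eqv (u ++ r ++ v) (u ++ v).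

Definition word_eqvb : rel word := fun u v => `[< word_eqv u v >].

Lemma word_eqvb_equiv : equiv_class_of word_eqvb.
Proof.
split.
- by move=> w; apply/asboolP; exact: word_eqv_refl.
- by move=> u v; apply/asboolP/asboolP; exact: word_eqv_sym.
- move=> v u w /asboolP uv /asboolP vw; apply/asboolP.
  exact: word_eqv_trans uv vw.
Qed.

Canonical word_eqv_rel := EquivRelPack word_eqvb_equiv.

Definition presented_group : Type := {eq_quot word_eqv_rel}.

HB.instance Definition _ := Choice.on presented_group.
HB.instance Definition _ := EqQuotient.on presented_group.

Definition word_class (w : word) : presented_group := \pi_presented_group w.

Lemma word_classP (u v : word) :
  word_class u = word_class v <-> word_eqv u v.
Proof. by split=> [/eqmodP /asboolP|uv]; last by apply/eqmodP/asboolP. Qed.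

Lemma flipK : involutive flip.
Proof. by case=> x b; rewrite /flip negbK. Qed.

Lemma word_invK : involutive word_inv.
Proof. by move=> w; rewrite /word_inv map_rev revK (mapK flipK). Qed.

Lemma word_inv_cat (u v : word) : word_inv (u ++ v) = word_inv v ++ word_inv u.
Proof. by rewrite /word_inv map_cat rev_cat. Qed.

Lemma word_eqv_cat (u u' v v' : word) :
  word_eqv u u' -> word_eqv v v' -> word_eqv (u ++ v) (u' ++ v').
Proof.
have ctx p q s t : word_eqv s t -> word_eqv (p ++ s ++ q) (p ++ t ++ q).
  elim=> [w|{}s {}t _|{}s w {}t _ sw _|{}s {}t l|{}s {}t r Rr].
  - exact: word_eqv_refl.
  - exact: word_eqv_sym.
  - exact: word_eqv_trans.
  - rewrite -!catA /= !catA -[_ ++ l :: _]/(_ ++ [:: l, flip l & _]) -catA.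
    by have := word_eqv_cancel (p ++ s) (t ++ q) l; rewrite -!catA.
  - by have := word_eqv_relator (p ++ s) (t ++ q) Rr; rewrite -!catA.
move=> uu vv; apply: (word_eqv_trans (v := u' ++ v)).
  exact: (ctx [::] v).
by have := ctx u' [::] _ _ vv; rewrite !cats0.
Qed.

Lemma word_eqv_mulV (w : word) : word_eqv (w ++ word_inv w) [::].
Proof.
elim/last_ind: w => [|w l IH]; first exact: word_eqv_refl.
apply: word_eqv_trans IH.
rewrite -cats1 word_inv_cat -catA.
exact: word_eqv_cancel.
Qed.

Lemma word_eqv_inv (u v : word) :
  word_eqv u v -> word_eqv (word_inv u) (word_inv v).
Proof.
move=> uv; apply: (word_eqv_trans (v := word_inv u ++ v ++ word_inv v)).
  rewrite -[X in word_eqv X _]cats0; apply: word_eqv_cat (word_eqv_refl _) _.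
  exact/word_eqv_sym/word_eqv_mulV.
rewrite catA -[X in word_eqv _ X]/([::] ++ _).
apply: word_eqv_cat (word_eqv_refl _).
apply: (word_eqv_trans (v := word_inv u ++ u)).
  exact: word_eqv_cat (word_eqv_refl _) (word_eqv_sym uv).
by have := word_eqv_mulV (word_inv u); rewrite word_invK.
Qed.

Definition pres_one : presented_group := word_class [::].
Definition pres_mul (x y : presented_group) : presented_group :=
  word_class (repr x ++ repr y).
Definition pres_inv (x : presented_group) : presented_group :=
  word_class (word_inv (repr x)).

Lemma word_class_surj (x : presented_group) : exists w, x = word_class w.
Proof. by exists (repr x); rewrite /word_class reprK. Qed.

Lemma repr_word_class (w : word) : word_eqv (repr (word_class w)) w.
Proof. by apply/word_classP; rewrite /word_class reprK. Qed.

Lemma pres_mulE (u v : word) :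
  pres_mul (word_class u) (word_class v) = word_class (u ++ v).
Proof. by apply/word_classP/word_eqv_cat; exact: repr_word_class. Qed.

Lemma pres_invE (w : word) : pres_inv (word_class w) = word_class (word_inv w).
Proof. by apply/word_classP/word_eqv_inv; exact: repr_word_class. Qed.

Lemma pres_mulA : associative pres_mul.
Proof.
move=> x y z.
have [u ->] := word_class_surj x; have [v ->] := word_class_surj y.
by have [w ->] := word_class_surj z; rewrite !pres_mulE catA.
Qed.

Lemma pres_mul1 : left_id pres_one pres_mul.
Proof. by move=> x; have [u ->] := word_class_surj x; rewrite pres_mulE. Qed.

Lemma pres_mulr1 : right_id pres_one pres_mul.
Proof.
by move=> x; have [u ->] := word_class_surj x; rewrite pres_mulE cats0.
Qed.

Lemma pres_mulV : left_inverse pres_one pres_inv pres_mul.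
Proof.
move=> x; have [u ->] := word_class_surj x; rewrite pres_invE pres_mulE.
apply/word_classP.
by have := word_eqv_mulV (word_inv u); rewrite word_invK.
Qed.

Lemma pres_mulrV : right_inverse pres_one pres_inv pres_mul.
Proof.
move=> x; have [u ->] := word_class_surj x; rewrite pres_invE pres_mulE.
by apply/word_classP/word_eqv_mulV.
Qed.

HB.instance Definition _ := isGroup.Build presented_group
  pres_mulA pres_mul1 pres_mulr1 pres_mulV pres_mulrV.

End Presentation.

(* The generator a is true, the generator b is false. *)
Definition Gmn_relator (m n : nat) : word bool :=
  word_comm (nseq m (true, false)) (nseq n (false, false)).

Definition Gmn (m n : nat) : groupType :=
  presented_group [set Gmn_relator m n].

Section NormalAutomorphisms.
Variable G : groupType.

Record normal_subgroup (N : set G) : Prop := NormalSubgroup {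
  normal_subgroup1 : N 1;
  normal_subgroupM : forall x y, N x -> N y -> N (x * y);
  normal_subgroupV : forall x, N x -> N x^-1;
  normal_subgroupJ : forall x g, N x -> N (x ^ g) }.

Definition normal_automorphism (f : {multiplicative G -> G}) : Prop :=
  bijective f /\ (forall N : set G, normal_subgroup N -> f @` N = N).

Definition inner_automorphism (f : {multiplicative G -> G}) : Prop :=
  exists g : G, forall x : G, f x = x ^ g.

End NormalAutomorphisms.

(* Main.v *)
Require Import Defs.
From mathcomp Require Import all_boot all_order all_algebra.
From mathcomp Require Import boolp classical_sets.
From mathcomp Require Import ring zify.

(** Write c = a^m and d = b^n. The group is the amalgam of the cyclic groups
  <a> and <b> with the free abelian group K = <c, d>, along <c> and <d>. The
  two generators play symmetric roles: they are [gen true] = a and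
  [gen false] = b, and [cen i] is c or d, central in a subgroup generated by
  [gen i] and K.

  Every element is, uniquely up to a right factor in K, a product of letters
  d^p a^s (0 < s < m) and c^p b^s (0 < s < n) in which a letter following one
  of the same type has p <> 0. The uniqueness is van der Waerden's argument:
  left multiplication is transcribed into an action of the group on reduced
  lists of letters. The exponents p may be taken in any ring R; with R = Z this
  yields normal forms, and with R = Z/N it tells elements of the quotient by
  c^N = d^N = 1 apart. The shape of the letters makes multiplication by c and d
  transparent: c adds 1 to the p of the first b-letter and d does so for the
  first a-letter. Hence the centraliser of c consists of the elements without
  b-letters ([commute_cen_form]).

  Let phi be a normal automorphism. It preserves each subgroup of the
  abelianisation Z^2 that is the kernel of a form, so it acts there by a sign
  eps ([exponent_phi]).
  Every element of the group is conjugate to an element of K, to a power of a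
  generator, or to a cyclically reduced product, whose powers are reduced
  ([conj_form_exists]). As a has finite order modulo c^N = d^N = 1, and phi
  preserves the normal subgroup in question, phi(a) has finite order there for
  every N, which excludes the third form; the abelianisation then leaves
  phi(a) = (a^eps)^g1, and likewise phi(b) = (b^eps)^g2 ([phi_gen]).
  Since c^g1 and d^g2 commute, g1 g2^-1 is a product xy with x centralising c
  and y centralising d ([commute_cen_conj]), so after one conjugation g1 and g2
  centralise c and d respectively. Then phi multiplies the number of a-letters
  by 2r + 1, where r is the number of a-letters of g1 that matter, and similarly
  for b ([count_psi]); as phi is onto, r = 0. So phi is conjugation by some t
  after a -> a^eps, b -> b^eps ([phi_standard]).
  Finally eps = 1, because the map inverting both generators does not preserve
  the kernel of the homomorphism to affine maps of (Z/n)[X]/(X^3 + X + 1) that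
  sends a to multiplication by X and b to translation by 1, the polynomial
  X^3 + X + 1 not being reciprocal. *)

Set Implicit Arguments.
Unset Strict Implicit.
Unset Printing Implicit Defensive.

Import GRing.Theory.
Local Open Scope group_scope.

(** * Integer powers and commuting elements *)

Section IntegerPowers.
Variable G : groupType.
Implicit Types (x y g h : G) (p q : int).

Definition zpow x p : G :=
  match p with Posz k => x ^+ k | Negz k => x ^- k.+1 end.

(** Writing an exponent as a difference of naturals avoids the sign cases. *)
Lemma zpowB x (k l : nat) : zpow x (k%:Z - l%:Z)%R = x ^+ k / x ^+ l.
Proof.
have [lk|kl] := leqP l k.
  by rewrite subzn //= expgnFr.
have -> : (k%:Z - l%:Z)%R = Negz (l - k).-1 by lia.
rewrite /= prednK ?subn_gt0 // expgnFr ?(ltnW kl) // invgM invgK.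
by [].
Qed.

Lemma int_diff p : exists k l : nat, p = (k%:Z - l%:Z)%R.
Proof.
case: p => k; first by exists k, 0; rewrite subr0.
by exists 0, k.+1; rewrite sub0r NegzE.
Qed.

Lemma commuteV2 x y : commute x y -> commute x^-1 y.
Proof. by move=> xy; apply/commute_sym/commuteV/commute_sym. Qed.

Lemma zpow_commute x y p : commute x y -> commute x (zpow y p).
Proof.
by move=> xy; case: p => k /=; [|apply: commuteV]; apply: commuteX.
Qed.

Lemma zpowD x p q : zpow x (p + q)%R = zpow x p * zpow x q.
Proof.
have [k [l ->]] := int_diff p; have [k' [l' ->]] := int_diff q.
have -> : (k%:Z - l%:Z + (k'%:Z - l'%:Z) = (k + k')%:Z - (l + l')%:Z)%R by lia.
rewrite !zpowB expgnDr addnC expgnDr invgM -!mulgA; congr (_ * _).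
rewrite !mulgA; congr (_ / _).
by apply/commute_sym/commuteV2; apply: commuteX2.
Qed.

Lemma zpowN x p : zpow x (- p)%R = (zpow x p)^-1.
Proof. by apply/esym/mulg1_eq; rewrite -zpowD subrr. Qed.

Lemma zpowMn x (k : nat) p : zpow x (p * k%:Z)%R = zpow (x ^+ k) p.
Proof.
have [r [s ->]] := int_diff p.
have -> : ((r%:Z - s%:Z) * k%:Z = (k * r)%:Z - (k * s)%:Z)%R by lia.
by rewrite !zpowB !expgnA.
Qed.

Lemma zpowX x (k : nat) p : zpow x p ^+ k = zpow x (p * k%:Z)%R.
Proof.
elim: k => [|k IH]; first by rewrite mulr0.
by rewrite expgS IH -zpowD; congr zpow; lia.
Qed.

Lemma zpowM x p q : zpow (zpow x p) q = zpow x (p * q)%R.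
Proof.
by case: q => k; rewrite /= zpowX // -zpowN NegzE mulrN.
Qed.

Lemma zpowJ x g p : zpow x p ^ g = zpow (x ^ g) p.
Proof. by case: p => k /=; rewrite ?conjVg conjXg. Qed.

Lemma conjg_commute x g : commute x g -> x ^ g = x.
Proof. by move=> xg; rewrite conjgE xg mulKg. Qed.

Lemma commute_conj g h x : commute g h -> commute g (h * x * h^-1) -> commute g x.
Proof.
move=> gh gx.
have -> : x = h^-1 * (h * x * h^-1) * h.
  by rewrite !mulgA mulVg mul1g -mulgA mulVg mulg1.
by apply: commuteM => //; apply: commuteM => //; apply: commuteV.
Qed.

Lemma conj_mulr g h x : commute x h -> g * h * x / (g * h) = g * x / g.
Proof. by move=> xh; rewrite invgM !mulgA -(mulgA g h) -xh mulgA mulgK. Qed.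

End IntegerPowers.

Section Morphisms.
Variables (G H : groupType) (f : G -> H).
Hypothesis fM : {morph f : x y / x * y}.

Lemma morph_one : f 1 = 1.
Proof. by apply: (mulgI (f 1)); rewrite -fM !mulg1. Qed.

Lemma morph_inv x : f x^-1 = (f x)^-1.
Proof. by apply/esym/mulg1_eq; rewrite -fM mulgV morph_one. Qed.

Lemma morph_zpow x p : f (zpow x p) = zpow (f x) p.
Proof.
have X k : f (x ^+ k) = f x ^+ k.
  by elim: k => [|k IH]; rewrite ?morph_one // !expgS fM IH.
by case: p => k; rewrite /= ?morph_inv X.
Qed.

End Morphisms.

(** * The group by generators, and its actions *)

Section Presentation.
Variables m n : nat.

Definition expo (i : bool) := if i then m else n.

Definition gen (i : bool) : Gmn m n :=
  word_class [set Gmn_relator m n]%classic [:: (i, false)].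

(** This is c = a^m or d = b^n. *)
Definition cen (i : bool) : Gmn m n := gen i ^+ expo i.

Lemma word_class_mul (u v : word bool) :
  word_class [set Gmn_relator m n]%classic (u ++ v) =
  (word_class _ u * word_class _ v : Gmn m n).
Proof. by rewrite -[RHS]/(pres_mul _ _) pres_mulE. Qed.

Lemma word_class_inv (u : word bool) :
  word_class [set Gmn_relator m n]%classic (word_inv u) =
  ((word_class _ u : Gmn m n)^-1).
Proof. by rewrite -[RHS]/(pres_inv _) pres_invE. Qed.

Lemma word_class_nseq i k :
  word_class [set Gmn_relator m n]%classic (nseq k (i, false)) = gen i ^+ k.
Proof.
elim: k => [//|k IH]; rewrite expgS -IH -word_class_mul.
by [].
Qed.

Lemma cen_commute i j : commute (cen i) (cen j).
Proof.
suff tf : commute (cen true) (cen false).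
  by case: i; case: j => //; apply: commute_sym.
apply/commgP/eqP.
have <- : word_class _ (Gmn_relator m n) = 1 :> Gmn m n.
  apply/word_classP.
  have := @word_eqv_relator bool [set Gmn_relator m n]%classic [::] [::] _ erefl.
  by rewrite cats0.
rewrite !word_class_mul !word_class_inv !word_class_nseq.
by [].
Qed.

Lemma gen_commute_cen i : commute (gen i) (cen i).
Proof. exact: commuteX. Qed.

Lemma Gmn_ind (P : Gmn m n -> Prop) :
    P 1 -> (forall i g, P g -> P (gen i * g)) ->
    (forall i g, P g -> P ((gen i)^-1 * g)) ->
  forall g, P g.
Proof.
move=> P1 PM PV g; have [w ->] := word_class_surj g.
elim: w => [//|[i b] w IH].
rewrite -cat1s word_class_mul.
case: b; last exact: PM.
by rewrite -[[:: (i, true)]]/(word_inv [:: (i, false)]) word_class_inv; exact: PV.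
Qed.

(** The maps are total on [T] and obey the axioms on the invariant part [dom],
  so that the group can act on raw lists of which only the reduced ones obey
  the defining relation. *)
Record action (T : Type) := Action {
  dom : T -> Prop;
  move : bool -> T -> T;
  back : bool -> T -> T;
  dom_move : forall i t, dom t -> dom (move i t);
  dom_back : forall i t, dom t -> dom (back i t);
  moveK : forall i t, dom t -> back i (move i t) = t;
  backK : forall i t, dom t -> move i (back i t) = t;
  move_comm : forall t, dom t ->
    iter m (move true) (iter n (move false) t) =
    iter n (move false) (iter m (move true) t) }.

Section Action.
Variables (T : Type) (A : action T).

Definition word_act (w : word bool) (t : T) : T :=
  foldr (fun l => if l.2 then back A l.1 else move A l.1) t w.

Definition act (g : Gmn m n) : T -> T := word_act (repr g).

Lemma word_act_cat u v t : word_act (u ++ v) t = word_act u (word_act v t).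
Proof. exact: foldr_cat. Qed.

Lemma dom_word_act w t : dom A t -> dom A (word_act w t).
Proof.
by elim: w => //= -[i []] w IH /IH; [exact: dom_back|exact: dom_move].
Qed.

Lemma word_act_inv w t :
  dom A t -> word_act (word_inv w) (word_act w t) = t.
Proof.
elim: w t => //= -[i b] w IH t dt.
rewrite -cat1s word_inv_cat word_act_cat /=; have dw := dom_word_act w dt.
by case: b; rewrite /= ?backK ?moveK // IH.
Qed.

Lemma word_act_nseq i k t :
  word_act (nseq k (i, false)) t = iter k (move A i) t.
Proof. by elim: k => //= k ->. Qed.

Lemma word_act_eqv u v :
    word_eqv [set Gmn_relator m n]%classic u v ->
  forall t, dom A t -> word_act u t = word_act v t.
Proof.
elim=> {u v} [//|u v _ IH t dt|u v w _ IH1 _ IH2 t dt|u v l t dt|u v r -> t dt].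
- by rewrite IH.
- by rewrite IH1 ?IH2.
- rewrite -[_ :: _]/([:: l; flip l] ++ v) !word_act_cat; congr word_act.
  by case: l => i [] /=; rewrite ?moveK ?backK //; apply: dom_word_act.
rewrite /Gmn_relator /word_comm !word_act_cat; congr word_act.
have := dom_word_act v dt; move: (word_act v t) => s ds.
rewrite !word_act_nseq move_comm // -!word_act_nseq.
by rewrite !word_act_inv //; apply: dom_word_act.
Qed.

Lemma act_word w t : dom A t -> act (word_class _ w) t = word_act w t.
Proof. by move=> dt; apply: word_act_eqv => //; apply: repr_word_class. Qed.

Lemma dom_act g t : dom A t -> dom A (act g t).
Proof. exact: dom_word_act. Qed.

Lemma act1 t : dom A t -> act 1 t = t.
Proof. by move=> dt; rewrite -[1]/(word_class _ [::]) act_word. Qed.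

Lemma actM g h t : dom A t -> act (g * h) t = act g (act h t).
Proof.
move=> dt; rewrite -[_ * _]/(word_class _ (repr g ++ repr h)) act_word //.
exact: word_act_cat.
Qed.

Lemma act_gen i t : dom A t -> act (gen i) t = move A i t.
Proof. by move=> dt; rewrite act_word. Qed.

Lemma act_genV i t : dom A t -> act (gen i)^-1 t = back A i t.
Proof. by move=> dt; rewrite -word_class_inv act_word. Qed.

Lemma actK g t : dom A t -> act g^-1 (act g t) = t.
Proof. by move=> dt; rewrite -actM // mulVg act1. Qed.

Lemma act_genX i k t : dom A t -> act (gen i ^+ k) t = iter k (move A i) t.
Proof.
move=> dt; elim: k => [|k IH]; first exact: act1.
by rewrite expgS actM // IH act_gen // -IH; exact: dom_act.
Qed.

Definition kernel : set (Gmn m n) :=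
  [set g | forall t, dom A t -> act g t = t]%classic.

Lemma kernel_normal : normal_subgroup kernel.
Proof.
split=> [t dt|x y Kx Ky t dt|x Kx t dt|x g Kx t dt].
- exact: act1.
- by rewrite actM // Ky ?Kx.
- by rewrite -{1}(Kx t dt) actK.
- by rewrite conjgE !actM ?Kx ?actK //; apply: dom_act.
Qed.

End Action.

End Presentation.

(** * The action on reduced lists of letters *)

Section NormalForms.
Variables m n : nat.
Hypotheses (m_gt1 : 1 < m) (n_gt1 : 1 < n).
Notation expo := (expo m n).

Lemma expo_gt1 i : 1 < expo i. Proof. by case: i. Qed.
Hint Resolve expo_gt1 : core.

Section Lists.
Variable R : nzRingType.

Local Notation letter := (bool * R * nat)%type.
Implicit Types (w : seq letter) (i j : bool) (p q : R).

(** A letter (i, p, s) stands for [cen (~~ i)] ^ p * [gen i] ^ s. A list is fresh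
  for [i] when no power of [gen i] written on its left merges with its first
  letter. *)
Definition fresh i w :=
  if w is (j, q, _) :: _ then (j != i) || (q != 0%R) else true.

Fixpoint reduced w :=
  if w is (i, p, s) :: w' then [&& 0 < s < expo i, fresh i w' & reduced w']
  else true.

(** Left multiplication by [cen i] ^ p: this element commutes with the letters
  of type [i], and is absorbed by the first letter of the other type. If there
  is none it disappears, because lists represent elements only up to a right
  factor in <c, d>. *)
Fixpoint shift i p w :=
  if w is (j, q, s) :: w' then
    if j == i then (j, q, s) :: shift i p w' else (j, (q + p)%R, s) :: w'
  else [::].

(** Left multiplication by [gen i]; a full power of [gen i] becomes [cen i] and
  moves on to the right. *)
Definition turn i w :=
  if fresh i w then (i, 0%R, 1%N) :: w else
  if w is (j, q, s) :: w' then
    if s.+1 < expo i then (j, q, s.+1) :: w' else shift i 1%R w'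
  else w.

(** The inverse x^-1 = x^(e - 1) (x^e)^-1, where x = [gen i] and e = [expo i]. *)
Definition unturn i w := iter (expo i).-1 (turn i) (shift i (- 1)%R w).

Definition count_type i w := count (fun l => l.1.1 == i) w.

Lemma shift0 i w : shift i 0%R w = w.
Proof. by elim: w => //= -[[j q] s] w ->; rewrite addr0; case: ifP. Qed.

Lemma shiftD i p q w : shift i p (shift i q w) = shift i (q + p)%R w.
Proof.
by elim: w => //= -[[j r] s] w IH; case: ifP => ji /=; rewrite ji ?IH ?addrA.
Qed.

Lemma shiftC i j p q w : shift i p (shift j q w) = shift j q (shift i p w).
Proof.
have [->|ij] := eqVneq i j; first by rewrite !shiftD addrC.
case: w => //= -[[k r] s] w.
by case: i j k ij => [] [] [].
Qed.

Lemma fresh_shift i p w : fresh i (shift i p w) = fresh i w.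
Proof.
by case: w => //= -[[j q] s] w; have [->|ji] := eqVneq j i; rewrite /= ?eqxx ?ji.
Qed.

Lemma reduced_shift i p w : reduced (shift i p w) = reduced w.
Proof.
elim: w => //= -[[j q] s] w IH; case: (eqVneq j i) => [->|ji] //=.
by rewrite fresh_shift IH.
Qed.

Lemma size_shift i p w : size (shift i p w) = size w.
Proof. by elim: w => //= -[[j q] s] w IH; case: ifP => //= _; rewrite IH. Qed.

Lemma count_shift i j p w : count_type j (shift i p w) = count_type j w.
Proof.
by elim: w => //= -[[k q] s] w IH; case: ifP => //= _; rewrite IH.
Qed.

Lemma all_shift i j p w :
  all (fun l => l.1.1 == j) (shift i p w) = all (fun l => l.1.1 == j) w.
Proof. by elim: w => //= -[[k q] s] w IH; case: ifP => //= _; rewrite IH. Qed.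

Lemma turn_fresh i s w :
  fresh i w -> 0 < s < expo i -> iter s (turn i) w = (i, 0%R, s) :: w.
Proof.
move=> fw; elim: s => [//|s IH] /=.
case: s IH => [_ _|s IH sM]; first by rewrite /= /turn fw.
have sM' : s.+2 < expo i := sM.
by rewrite IH ?(ltnW sM') // /turn /= !eqxx /= sM'.
Qed.

Lemma turn_expo_fresh i w :
  fresh i w -> iter (expo i) (turn i) w = shift i 1%R w.
Proof.
move=> fw; have M1 := expo_gt1 i.
have M0 : 0 < expo i by apply: ltnW.
rewrite -(prednK M0) /= turn_fresh //; last by rewrite -subn1 subn_gt0 M1 ltn_subrL M0.
by rewrite /turn /= !eqxx /= prednK // ltnn.
Qed.

Lemma unfresh i w : fresh i w = false -> exists s w', w = (i, 0%R, s) :: w'.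
Proof.
case: w => //= -[[j q] s] w; case: eqVneq => //= ->; case: eqVneq => //= -> _.
by exists s, w.
Qed.

(** If the list already starts with [gen i] ^ s, then the powers of [turn i]
  applied to the rest of the list contain it, and they commute. *)
Lemma turn_expo i w : reduced w -> iter (expo i) (turn i) w = shift i 1%R w.
Proof.
case fw: (fresh i w); first by move=> _; exact: turn_expo_fresh.
have [s [w' -> /= /and3P[sM fw' _]]] := unfresh fw.
rewrite -turn_fresh // -iterD addnC iterD turn_expo_fresh // eqxx.
by rewrite turn_fresh // fresh_shift.
Qed.

Lemma turn_shift i p w : turn i (shift i p w) = shift i p (turn i w).
Proof.
rewrite /turn fresh_shift; case: ifP => [_|fw]; first by rewrite /= eqxx.
have [s [w' ->]] := unfresh fw; rewrite /= eqxx.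
by case: ifP; rewrite /= ?eqxx // shiftC.
Qed.

Lemma reduced_turn i w : reduced w -> reduced (turn i w).
Proof.
rewrite /turn; case fw: (fresh i w) => rw; first by rewrite /= rw fw expo_gt1.
have [s [w' Dw]] := unfresh fw; move: rw; rewrite Dw /= => /and3P[_ fw' rw'].
by case: ifP => sM /=; rewrite ?sM ?fw' // reduced_shift.
Qed.

Lemma reduced_unturn i w : reduced w -> reduced (unturn i w).
Proof.
rewrite /unturn -(reduced_shift i (- 1)%R) => rw.
by elim: _.-1 => //= k; apply: reduced_turn.
Qed.

Lemma turn_unturn i w : reduced w -> turn i (unturn i w) = w.
Proof.
move=> rw; rewrite /unturn -iterS prednK ?(ltnW (expo_gt1 i)) //.
by rewrite turn_expo ?reduced_shift // shiftD addNr shift0.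
Qed.

Lemma unturn_turn i w : reduced w -> unturn i (turn i w) = w.
Proof.
move=> rw; rewrite /unturn -turn_shift -iterSr prednK ?(ltnW (expo_gt1 i)) //.
by rewrite turn_expo ?reduced_shift // shiftD addNr shift0.
Qed.

Lemma turn_comm w : reduced w ->
  iter m (turn true) (iter n (turn false) w) =
  iter n (turn false) (iter m (turn true) w).
Proof.
move=> rw.
have E i v : reduced v -> iter (expo i) (turn i) v = shift i 1%R v.
  exact: turn_expo.
rewrite -[m]/(expo true) -[n]/(expo false).
by rewrite !E ?reduced_shift //= shiftC.
Qed.

Definition list_action : action m n (seq letter) :=
  Action reduced_turn reduced_unturn unturn_turn turn_unturn turn_comm.

End Lists.

End NormalForms.

(** * Exponent sums *)

Section ExponentSums.
Variables m n : nat.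
Implicit Types (g h : Gmn m n) (i : bool).

Definition translate (i j : bool) (c t : int) : int :=
  if j == i then (t + c)%R else t.

Lemma translateK i j c t : translate i j (- c)%R (translate i j c t) = t.
Proof. by rewrite /translate; case: eqP => // _; rewrite addrK. Qed.

Lemma translateVK i j c t : translate i j c (translate i j (- c)%R t) = t.
Proof. by rewrite -{1}[c]opprK translateK. Qed.

Lemma iter_translate i j k t :
  iter k (translate i j 1%R) t = if j == i then (t + k%:Z)%R else t.
Proof.
elim: k => [|k /= ->]; first by rewrite /= addr0 if_same.
by rewrite /translate; case: (j == i) => //; lia.
Qed.

Lemma translate_comm i t : True ->
  iter m (translate i true 1%R) (iter n (translate i false 1%R) t) =
  iter n (translate i false 1%R) (iter m (translate i true 1%R) t).
Proof. by rewrite !iter_translate; case: i. Qed.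

Definition exponent_action i : action m n int :=
  @Action m n int (fun=> True) (fun j => translate i j 1%R)
    (fun j => translate i j (- 1)%R) (fun _ _ _ => I) (fun _ _ _ => I)
    (fun j t _ => translateK i j 1%R t) (fun j t _ => translateVK i j 1%R t)
    (translate_comm i).

Definition exponent i g : int := act (exponent_action i) g 0%R.

Lemma act_exponent i g t : act (exponent_action i) g t = (t + exponent i g)%R.
Proof.
rewrite /exponent; elim/Gmn_ind: g t => [t|j g IH t|j g IH t].
- by rewrite !act1 // addr0.
- rewrite !actM // !act_gen // IH [act _ _ 0%R]IH /= /translate add0r.
  by case: ifP => // _; rewrite addrA.
- rewrite !actM // !act_genV // IH [act _ _ 0%R]IH /= /translate add0r.
  by case: ifP => // _; rewrite addrA.
Qed.

Lemma exponentM i g h : exponent i (g * h) = (exponent i g + exponent i h)%R.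
Proof. by rewrite {1}/exponent actM // !act_exponent add0r addrC. Qed.

Lemma exponent1 i : exponent i 1 = 0%R.
Proof. exact: act1. Qed.

Lemma exponentV i g : exponent i g^-1 = (- exponent i g)%R.
Proof. by apply/eqP; rewrite -addr_eq0 -exponentM mulVg exponent1. Qed.

Lemma exponent_gen i j : exponent i (gen m n j) = (j == i).
Proof.
by rewrite /exponent act_gen //= /translate add0r; case: eqP.
Qed.

Lemma exponentJ i g h : exponent i (g ^ h) = exponent i g.
Proof. by rewrite conjgE !exponentM exponentV; ring. Qed.

Lemma exponentX i g k : exponent i (g ^+ k) = (exponent i g * k%:Z)%R.
Proof.
elim: k => [|k IH]; first by rewrite exponent1 mulr0.
by rewrite expgS exponentM IH; lia.
Qed.

Lemma exponent_zpow i g p : exponent i (zpow g p) = (exponent i g * p)%R.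
Proof. by case: p => k; rewrite /= ?exponentV exponentX // NegzE; lia. Qed.

Lemma exponent_cen i j : exponent i (cen m n j) = ((j == i) * expo m n j)%N.
Proof. by rewrite exponentX exponent_gen; lia. Qed.

End ExponentSums.

(** * Normal forms *)

Section Evaluation.
Variables m n : nat.
Hypotheses (m_gt1 : 1 < m) (n_gt1 : 1 < n).
Notation expo := (expo m n).
Notation gen := (gen m n).
Notation cen := (cen m n).
Implicit Types (g h k : Gmn m n) (i j : bool).

Notation letter := (bool * int * nat)%type.

Definition list_act (R : nzRingType) := act (list_action m_gt1 n_gt1 R).
Arguments list_act : clear implicits.

Lemma reduced_act (R : nzRingType) g (w : seq (bool * R * nat)) :
  reduced m n w -> reduced m n (list_act R g w).
Proof. exact: (@dom_act _ _ _ (list_action m_gt1 n_gt1 R)). Qed.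

Section ActionRules.
Variable R : nzRingType.
Implicit Type w : seq (bool * R * nat).

Lemma list_act1 w : reduced m n w -> list_act R 1 w = w.
Proof. by move=> rw; rewrite /list_act act1. Qed.

Lemma list_actM g h w : reduced m n w ->
  list_act R (g * h) w = list_act R g (list_act R h w).
Proof. by move=> rw; rewrite /list_act actM. Qed.

Lemma list_act_gen i w :
  reduced m n w -> list_act R (gen i) w = turn m n i w.
Proof. by move=> rw; rewrite /list_act act_gen. Qed.

Lemma list_act_genV i w :
  reduced m n w -> list_act R (gen i)^-1 w = unturn m n i w.
Proof. by move=> rw; rewrite /list_act act_genV. Qed.

Lemma list_act_genX i s w :
  reduced m n w -> list_act R (gen i ^+ s) w = iter s (turn m n i) w.
Proof. by move=> rw; rewrite /list_act act_genX. Qed.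

Lemma list_actK g w :
  reduced m n w -> list_act R g^-1 (list_act R g w) = w.
Proof. by move=> rw; rewrite /list_act actK. Qed.

End ActionRules.

Definition letter_elt (l : letter) : Gmn m n :=
  zpow (cen (~~ l.1.1)) l.1.2 * gen l.1.1 ^+ l.2.

Definition eval (w : seq letter) : Gmn m n :=
  foldr (fun l g => letter_elt l * g) 1 w.

Definition embed (R : nzRingType) (w : seq letter) : seq (bool * R * nat) :=
  [seq (l.1.1, l.1.2%:~R%R, l.2) | l <- w].
Arguments embed : clear implicits.

(** Membership in K = <c, d>. *)
Definition in_core k :=
  exists u v, k = zpow (cen true) u * zpow (cen false) v.

Lemma eval_cat u v : eval (u ++ v) = eval u * eval v.
Proof. by elim: u => /= [|l u ->]; rewrite ?mul1g ?mulgA. Qed.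

Lemma embed_int w : embed int w = w.
Proof.
by rewrite /embed -[RHS]map_id; apply: eq_map => -[[i p] s]; rewrite /= intz.
Qed.

Lemma zcen_commute i j p q : commute (zpow (cen i) p) (zpow (cen j) q).
Proof.
by apply: zpow_commute; apply/commute_sym/zpow_commute/cen_commute.
Qed.

Lemma in_coreP i k :
  in_core k <-> exists u v, k = zpow (cen i) u * zpow (cen (~~ i)) v.
Proof.
case: i => //; split=> -[u [v ->]]; exists v, u; exact: zcen_commute.
Qed.

Lemma in_core_zcen i p : in_core (zpow (cen i) p).
Proof. by apply/(in_coreP i); exists p, 0%R; rewrite mulg1. Qed.

Lemma in_core1 : in_core 1.
Proof. by exists 0%R, 0%R; rewrite mulg1. Qed.

Lemma in_coreM k k' : in_core k -> in_core k' -> in_core (k * k').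
Proof.
move=> [u [v ->]] [u' [v' ->]]; exists (u + u')%R, (v + v')%R.
rewrite !zpowD -!mulgA; congr (_ * _); rewrite !mulgA; congr (_ * _).
exact: zcen_commute.
Qed.

Lemma in_coreV k : in_core k -> in_core k^-1.
Proof.
move=> [u [v ->]]; exists (- u)%R, (- v)%R.
by rewrite invgM -!zpowN; apply: zcen_commute.
Qed.

Lemma in_core_commute k i : in_core k -> commute (cen i) k.
Proof.
move=> [u [v ->]].
by apply: commuteM; apply: zpow_commute; apply: cen_commute.
Qed.

Lemma letter_commute (l : letter) : commute (cen l.1.1) (letter_elt l).
Proof.
apply: commuteM; first exact/zpow_commute/cen_commute.
exact/commuteX/commute_sym/gen_commute_cen.
Qed.

Lemma eval_commute i w :
  all (fun l => l.1.1 == i) w -> commute (cen i) (eval w).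
Proof.
elim: w => [_|l w IH] /=; first exact: commute1.
case/andP=> /eqP li aw; apply: commuteM (IH aw).
by rewrite -li; exact: letter_commute.
Qed.

(** If all letters have type [i] then [cen i] passes through the whole list
  and comes out on the right. *)
Lemma eval_shift i p w :
  zpow (cen i) p * eval w =
  eval (shift i p w) *
    (if all (fun l => l.1.1 == i) w then zpow (cen i) p else 1).
Proof.
elim: w => [|[[j q] s] w IH] /=; first by rewrite mulg1 mul1g.
case: eqVneq => [->|ji] /=.
  rewrite -[RHS]mulgA -IH [LHS]mulgA [RHS]mulgA; congr (_ * _).
  by apply/commute_sym/zpow_commute/commute_sym/(letter_commute (i, q, s)).
have -> : j = ~~ i by case: i j ji {IH} => [] [].
rewrite mulg1 mulgA; congr (_ * _).
by rewrite /letter_elt /= negbK mulgA -zpowD addrC.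
Qed.

Lemma eval_shift_core i p w :
  exists2 k, in_core k & zpow (cen i) p * eval w = eval (shift i p w) * k.
Proof.
exists (if all (fun l => l.1.1 == i) w then zpow (cen i) p else 1).
  by case: ifP => _; [exact: in_core_zcen|exact: in_core1].
exact: eval_shift.
Qed.

Lemma eval_turn i w : reduced m n w ->
  exists2 k, in_core k & gen i * eval w = eval (turn m n i w) * k.
Proof.
rewrite /turn; case fw: (fresh i w) => rw.
  by exists 1; [exact: in_core1|rewrite mulg1 /= /letter_elt /= mul1g].
have [s [w' Dw]] := unfresh fw; move: rw; rewrite Dw /= => /and3P[sM fw' rw'].
rewrite mulgA [letter_elt _]mul1g -expgS.
case: ifP => sM'.
  by exists 1; [exact: in_core1|rewrite mulg1 /= /letter_elt /= mul1g].
have -> : s.+1 = expo i.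
  apply/eqP; rewrite eqn_leq [expo i <= _]leqNgt sM' andbT.
  by case/andP: sM.
exact: (eval_shift_core i 1%R).
Qed.

(** The action on lists is left multiplication modulo K, because it is so for
  the generators. *)
Lemma eval_act g w : reduced m n w ->
  exists2 k, in_core k & g * eval w = eval (list_act int g w) * k.
Proof.
move=> rw; elim/Gmn_ind: g => [|i g [k Kk E]|i g [k Kk E]].
- by exists 1; [exact: in_core1|rewrite list_act1 // mulg1 mul1g].
- have rg : reduced m n (list_act int g w) by apply: reduced_act.
  have [k' Kk' E'] := eval_turn i rg.
  exists (k' * k); first exact: in_coreM.
  by rewrite list_actM // list_act_gen // -mulgA E mulgA E' mulgA.
- have rg : reduced m n (list_act int g w) by apply: reduced_act.
  have ru : reduced m n (unturn m n i (list_act int g w)).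
    exact: reduced_unturn.
  have [k' Kk' E'] := eval_turn i ru.
  exists (k'^-1 * k); first exact/in_coreM/Kk/in_coreV.
  rewrite list_actM // list_act_genV // -mulgA E mulgA mulgA; congr (_ * _).
  rewrite turn_unturn // in E'.
  by apply: (mulgI (gen i)); rewrite mulVKg mulgA E' mulgK.
Qed.

Definition normal_form g : seq letter := list_act int g [::].

Lemma reduced_normal_form g : reduced m n (normal_form g).
Proof. exact: reduced_act. Qed.

Lemma eval_normal_form g : exists2 k, in_core k & g = eval (normal_form g) * k.
Proof. by have [//|k Kk] := @eval_act g [::]; rewrite mulg1; exists k. Qed.

Section ListAction.
Variable R : nzRingType.
Implicit Type w : seq (bool * R * nat).

Lemma act_cenX i (k : nat) w :
  reduced m n w -> list_act R (cen i ^+ k) w = shift i (k%:R)%R w.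
Proof.
move=> rw; elim: k => [|k IH]; first by rewrite shift0 list_act1.
rewrite expgS list_actM // IH list_act_genX ?reduced_shift //.
by rewrite turn_expo ?reduced_shift // shiftD -natr1.
Qed.

Lemma act_cen i w :
  reduced m n w -> list_act R (cen i) w = shift i 1%R w.
Proof. exact: (act_cenX i 1). Qed.

Lemma act_zcen i p w :
  reduced m n w -> list_act R (zpow (cen i) p) w = shift i (p%:~R)%R w.
Proof.
move=> rw; have [k [l ->]] := int_diff p.
have E : list_act R (cen i ^- l) w = shift i (- l%:R)%R w.
  have {1}-> : w = list_act R (cen i ^+ l) (shift i (- l%:R)%R w).
    by rewrite act_cenX ?reduced_shift // shiftD addNr shift0.
  by rewrite list_actK // reduced_shift.
rewrite zpowB list_actM // E act_cenX ?reduced_shift //.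
by rewrite shiftD intrB /= addrC.
Qed.

Lemma act_core k : in_core k -> list_act R k [::] = [::].
Proof. by move=> [u [v ->]]; rewrite list_actM // !act_zcen. Qed.

Lemma act_letter i p s w : 0 < s < expo i -> fresh i w -> reduced m n w ->
  list_act R (letter_elt (i, p, s)) w = (i, p%:~R%R, s) :: w.
Proof.
move=> sM fw rw; rewrite list_actM // list_act_genX //= turn_fresh //.
rewrite act_zcen /= ?sM ?fw ?rw //.
by case: i {sM fw} => /=; rewrite add0r.
Qed.

(** A reduced product acts by concatenation, provided that its exponents, read in
  [R], still make the result reduced; this separates elements. *)
Lemma act_eval (u : seq letter) w :
  reduced m n (embed R u ++ w) -> list_act R (eval u) w = embed R u ++ w.
Proof.
elim: u => [|[[i p] s] u IH] /= => [rw|/and3P[sM fw rw]].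
  by rewrite list_act1.
have rw' : reduced m n w.
  by elim: (u) rw {IH fw} => //= l u' IH; case: (l) => [[? ?] ?] /= /and3P[_ _ /IH].
rewrite list_actM // IH //.
exact: act_letter.
Qed.

End ListAction.

Lemma normal_form_eval w : reduced m n w -> normal_form (eval w) = w.
Proof.
move=> rw; rewrite /normal_form act_eval ?cats0 ?embed_int //.
Qed.

End Evaluation.

Arguments list_act {m n} m_gt1 n_gt1 R g w.
Arguments embed R w : clear implicits.

(** * Conjugacy *)

Section Conjugacy.
Variables m n : nat.
Hypotheses (m_gt1 : 1 < m) (n_gt1 : 1 < n).
Notation expo := (expo m n).
Notation gen := (gen m n).
Notation cen := (cen m n).
Notation letter := (bool * int * nat)%type.
Notation list_act := (list_act m_gt1 n_gt1).
Notation eval := (eval m n).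
Notation normal_form := (normal_form m_gt1 n_gt1).
Implicit Types (g h k z : Gmn m n) (i j : bool) (w : seq letter).

Lemma neq_negb i j : j != i -> j = ~~ i.
Proof. by case: i; case: j. Qed.

Lemma reduced_cat (R : nzRingType) (u v : seq (bool * R * nat)) l :
  reduced m n (rcons u l ++ v) =
  [&& reduced m n (rcons u l), fresh l.1.1 v & reduced m n v].
Proof.
elim: u => [|[[i p] s] u IH] /=.
  by case: l => [[i p] s] /=; rewrite andbT; case: (_ < s < _).
rewrite IH; case: u {IH} => [|[[i' p'] s'] u] /=; rewrite -!andbA //.
Qed.

Lemma reduced_rcons (R : nzRingType) (u : seq (bool * R * nat)) l :
  reduced m n (rcons u l) -> reduced m n u.
Proof.
elim: u => [//|[[i p] s] u IH] /= /and3P[-> fu /IH ->].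
by case: u fu {IH} => //= -[[i' p'] s'] u ->.
Qed.

Lemma eval_rcons w l : eval (rcons w l) = eval w * letter_elt m n l.
Proof. by rewrite -cats1 eval_cat /= mulg1. Qed.

(** The condition under which the concatenation of a reduced list with itself is
  reduced. *)
Definition cyclically_reduced w :=
  if w is l :: w' then fresh (last l w').1.1 w else true.

Lemma reduced_power w c : reduced m n w -> cyclically_reduced w ->
  reduced m n (flatten (nseq c w)).
Proof.
case/lastP: w => [_ _|w l rw cw]; first by elim: c.
elim: c => [//|c IH]; rewrite /= reduced_cat rw IH andbT /=.
case: c {IH} => [//|c] /=.
case: w cw {rw} => [|l' w] /=; first by case: l => [[? ?] ?].
by rewrite last_rcons; case: l' => [[? ?] ?].
Qed.

Lemma eval_power w c : eval (flatten (nseq c w)) = eval w ^+ c.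
Proof. by elim: c => //= c IH; rewrite eval_cat IH expgS. Qed.

Lemma normal_form_core w k :
  reduced m n w -> in_core k -> normal_form (eval w * k) = w.
Proof.
move=> rw kK; rewrite /normal_form list_actM // act_core //.
exact: normal_form_eval.
Qed.

Variant conj_form g : Prop :=
| ConjCore of in_core g
| ConjPower i p of g = zpow (gen i) p
| ConjCyclic w z of g = eval w * z & w != [::] & reduced m n w
    & cyclically_reduced w & in_core z & commute (eval w) z.

(** Conjugating by the factor in K moves it to the left, where it is absorbed up
  to a power of [cen i] that commutes with the list. If the resulting list is not
  cyclically reduced then it starts with [gen i] ^ s and ends with a letter of
  type [i], and conjugating by [gen i] ^ s merges the two and shortens the
  list. *)
Lemma conj_form_exists g : exists h, conj_form (g ^ h).
Proof.
move: {2}_.+1 (ltnSn (size (normal_form g))) => c.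
elim: c g => [//|c IH] g; rewrite ltnS => sg.
have [k kK Dg] := eval_normal_form m_gt1 n_gt1 g.
have rw := reduced_normal_form m_gt1 n_gt1 g.
move: sg rw Dg; move: (normal_form g) => w sw rw Dg.
case: w sw rw Dg => [|[[i p] s] w] sw rw Dg.
  by exists 1; rewrite conjg1 Dg mul1g; apply: ConjCore.
have [u [v Dk]] := proj1 (in_coreP i k) kK.
pose w2 := shift i u w; pose w1 := (i, (p + v)%R, s) :: w2.
have rw1 : reduced m n w1 by move: rw; rewrite /= fresh_shift reduced_shift.
have sw2 : size w2 < c by rewrite size_shift.
have [u' Dg1 cw1] : exists2 u', g ^ k^-1 = eval w1 * zpow (cen i) u' &
    commute (eval w1) (zpow (cen i) u').
  pose w0 := (i, (p + v)%R, s) :: w.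
  have Dkw : k * eval ((i, p, s) :: w) =
      eval w1 * (if all (fun l => l.1.1 == i) w0 then zpow (cen i) u else 1).
    have ii : (i == ~~ i) = false by case: (i).
    have sh : shift (~~ i) v ((i, p, s) :: w) = w0 by rewrite /= ii.
    have nall : all (fun l => l.1.1 == ~~ i) ((i, p, s) :: w) = false.
      by rewrite /= ii.
    rewrite Dk -[LHS]mulgA eval_shift nall mulg1 sh eval_shift.
    by rewrite /w0 [shift i u _]/= eqxx.
  have Dg1 : g ^ k^-1 = k * eval ((i, p, s) :: w).
    by rewrite conjgE invgK Dg mulgK.
  rewrite Dg1 Dkw; case: ifP => [al|_].
    exists u => //; apply/zpow_commute/commute_sym/eval_commute.
    by rewrite /= all_shift.
  by exists 0%R => //; apply: commute1.
case cyc: (cyclically_reduced w1).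
  by exists k^-1; apply: (ConjCyclic Dg1) => //; apply: in_core_zcen.
move: cyc Dg1 rw1 sw2; rewrite /w1 /=; case/lastP: w2 {w1 cw1} => [|w2 [[j q] t]].
  rewrite /= eqxx /= => /negbFE/eqP -> Dg1 _ _.
  exists k^-1; apply: (ConjPower (i := i) (p := (s%:Z + u' * (expo i)%:Z)%R)).
  by rewrite Dg1 /= mulg1 zpowD zpowMn /letter_elt /= mul1g.
rewrite last_rcons /=; case: eqVneq => //= <- {j} /negbFE/eqP ->.
move=> Dg1 /and3P[_ _ rw2] sw2.
set z := zpow (cen i) u' in Dg1; set y := zpow (cen (~~ i)) q.
set g1 := g ^ k^-1 in Dg1.
have xz e : commute (gen i ^+ e) z.
  exact/zpow_commute/commute_sym/commuteX/commute_sym/gen_commute_cen.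
have Dg2 : g1 ^ (gen i ^+ s) = eval w2 * (y * gen i ^+ (t + s)) * z.
  rewrite conjgE Dg1 -cats1 /= eval_cat /letter_elt /= !mul1g mulg1.
  rewrite -/y -!mulgA mulKg expgnDr; congr (_ * (_ * _)).
  by rewrite -mulgA xz.
(* The merged letter has exponent (t + s) modulo [expo i]; the excess is a power
   of [cen i]. *)
have [h Hh] : exists h, conj_form ((g1 ^ (gen i ^+ s)) ^ h).
  apply: IH; rewrite {}Dg2.
  have e0 : 0 < expo i by apply: ltnW; exact: expo_gt1.
  pose z' := zpow (cen i) (((t + s) %/ expo i)%:Z + u')%R.
  have -> : eval w2 * (y * gen i ^+ (t + s)) * z =
            eval w2 * (y * gen i ^+ ((t + s) %% expo i)) * z'.
    rewrite /z' zpowD {1}(divn_eq (t + s) (expo i)) addnC expgnDr mulnC expgnA.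
    by rewrite !mulgA.
  have zK : in_core z' by apply: in_core_zcen.
  rewrite size_rcons in sw2.
  have [r0|r0] := posnP ((t + s) %% expo i).
    rewrite r0 mulg1 -mulgA normal_form_core ?(ltnW sw2) //.
      exact: reduced_rcons rw2.
    exact/in_coreM/zK/in_core_zcen.
  have -> : eval w2 * (y * gen i ^+ ((t + s) %% expo i)) =
            eval (rcons w2 (i, q, (t + s) %% expo i)).
    by rewrite -cats1 eval_cat /= mulg1.
  rewrite normal_form_core ?size_rcons //; move: rw2; rewrite -!cats1.
  case/lastP: (w2) => [|w3 l] /=; first by rewrite r0 ltn_mod e0.
  by rewrite !reduced_cat /= r0 ltn_mod e0 => /and3P[-> -> _].
by exists (k^-1 * gen i ^+ s * h); rewrite !conjgM.
Qed.

(** * Centralisers *)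

(** The inverse x^-s of a power of x = [gen i] is x^(e - s) times [cen i]^-1. *)
Lemma act_letterV i p s w : 0 < s < expo i ->
    fresh i (shift (~~ i) (- p)%R w) -> reduced m n w ->
  list_act int (letter_elt m n (i, p, s))^-1 w =
  (i, 0%R, expo i - s) :: shift i (- 1)%R (shift (~~ i) (- p)%R w).
Proof.
move=> sM fw rw; set w1 := shift (~~ i) _ w.
have sM' : 0 < expo i - s < expo i.
  by case/andP: sM => s0 sM; rewrite subn_gt0 sM ltn_subrL s0 (ltn_trans s0).
have rw1 : reduced m n w1 by rewrite reduced_shift.
have fw2 : fresh i (shift i (- 1)%R w1) by rewrite fresh_shift.
have rw2 : reduced m n ((i, 0%R, expo i - s) :: shift i (- 1)%R w1).
  by rewrite /= sM' fw2 reduced_shift.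
rewrite invgM list_actM // -zpowN act_zcen // intz -/w1.
rewrite -[RHS](list_actK _ _ (gen i ^+ s)) //; congr list_act.
rewrite list_act_genX // -(turn_fresh fw2 sM') -iterD subnKC; last first.
  by case/andP: sM => _ /ltnW.
by rewrite turn_expo_fresh // shiftD addNr shift0.
Qed.

(** Inverting letter by letter, each power of [gen i] stays separated from the
  next one, so nothing merges and the last letter comes first. *)
Lemma normal_form_inv u i p s : reduced m n (rcons u (i, p, s)) ->
  fresh i (normal_form (eval (rcons u (i, p, s)))^-1) = false.
Proof.
elim/last_ind: u i p s => [|u [[j q] t] IH] i p s ru.
  move: ru => /= /andP[sM _]; rewrite mulg1 /normal_form act_letterV //=.
  by rewrite !eqxx.
have : reduced m n (rcons u (j, q, t) ++ [:: (i, p, s)]) by rewrite cats1.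
rewrite reduced_cat => /and3P[ru' fi /= /andP[sM _]].
rewrite eval_rcons invgM /normal_form list_actM //.
rewrite act_letterV //= ?eqxx //; last exact: reduced_act.
have := IH _ _ _ ru'; rewrite /normal_form => /unfresh[s' [w' ->]] /=.
move: fi; case: (eqVneq j i) => [->|ji] /=.
  by rewrite eqxx orFb => p0; case: (i) => /=; rewrite add0r oppr_eq0 p0.
by rewrite (neq_negb ji); case: (i).
Qed.

(** Peel off from [h] the initial letters commuting with [cen i] and the final
  ones commuting with [cen (~~ i)]. If something remains, it starts with a letter
  of type [~~ i] and ends with one of type [i]; then so does the conjugate of
  [cen (~~ i)] by [h], which is thus changed by [cen i]. *)
Lemma commute_cen_conj i h : commute (cen i) (h * cen (~~ i) * h^-1) ->
  exists x y, [/\ h = x * y, commute (cen i) x & commute (cen (~~ i)) y].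
Proof.
have [k kK ->] := eval_normal_form m_gt1 n_gt1 h.
have rw := reduced_normal_form m_gt1 n_gt1 h.
move: rw; move: (normal_form h) => w rw.
rewrite conj_mulr; last exact: in_core_commute.
suff {k kK} H : commute (cen i) (eval w * cen (~~ i) / eval w) ->
    exists x y, [/\ eval w = x * y, commute (cen i) x & commute (cen (~~ i)) y].
  move=> /H[x [y [-> cx cy]]]; exists x, (y * k); split; rewrite ?mulgA //.
  exact/(commuteM cy)/in_core_commute.
move: {2}_.+1 (ltnSn (size w)) rw => c.
elim: c w => [//|c IH] [|[[j p] s] w].
  by move=> _ _ _; exists 1, 1; rewrite mulg1; split=> //; apply: commute1.
rewrite ltnS => sw rw; case: (eqVneq j i) => [Dj|ji].
  have cl : commute (cen i) (letter_elt m n (j, p, s)).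
    by rewrite -Dj; exact: (letter_commute m n (j, p, s)).
  move=> cc; have rw' : reduced m n w by case/and3P: rw.
  have [|x [y [Dx cx cy]]] := IH w sw rw'.
    by apply: commute_conj cl _; move: cc; rewrite /= invgM !mulgA.
  exists (letter_elt m n (j, p, s) * x), y.
  by split=> //; [rewrite /= Dx mulgA|apply: commuteM].
have {ji}Dj := neq_negb ji.
subst j.
case/lastP: w sw rw => [|u [[j q] t]] sw rw cc.
  exists 1, (eval [:: (~~ i, p, s)]); rewrite mul1g; split=> //.
    exact: commute1.
  by rewrite /= mulg1; exact: (letter_commute m n (~~ i, p, s)).
have [Dj|] := eqVneq j (~~ i).
  have cl : commute (cen (~~ i)) (letter_elt m n (j, q, t)).
    by rewrite -Dj; exact: (letter_commute m n (j, q, t)).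
  have Dw : eval ((~~ i, p, s) :: rcons u (j, q, t)) =
      eval ((~~ i, p, s) :: u) * letter_elt m n (j, q, t).
    by rewrite -rcons_cons eval_rcons.
  have [|||x [y [Dx cx cy]]] := IH ((~~ i, p, s) :: u).
  - by move: sw; rewrite /= size_rcons.
  - by apply: (@reduced_rcons _ _ (j, q, t)); rewrite rcons_cons.
  - by move: cc; rewrite Dw conj_mulr.
  exists x, (y * letter_elt m n (j, q, t)).
  by split=> //; [rewrite Dw Dx (mulgA x y)|apply: commuteM].
move/neq_negb; rewrite negbK => Dj; subst j; exfalso.
(* The inverse of W starts with a bare power of [gen i]; [cen (~~ i)] puts the
   exponent 1 in front of it, so that W can be written to its left unchanged. *)
set W := (~~ i, p, s) :: rcons u (i, q, t) in sw rw cc.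
have DW : W = rcons ((~~ i, p, s) :: u) (i, q, t) by [].
have [s' [v' Dv]] : exists s' v', normal_form (eval W)^-1 = (i, 0%R, s') :: v'.
  by apply: unfresh; rewrite DW; apply: normal_form_inv; rewrite -DW.
have rX : reduced m n (shift (~~ i) 1%R (normal_form (eval W)^-1)).
  by rewrite reduced_shift; apply: reduced_normal_form.
have fX : fresh i (shift (~~ i) 1%R (normal_form (eval W)^-1)).
  by rewrite Dv; case: (i).
have rWX : reduced m n (W ++ shift (~~ i) 1%R (normal_form (eval W)^-1)).
  rewrite DW (@reduced_cat int ((~~ i, p, s) :: u) _ (i, q, t)).
  by apply/and3P; split.
have E : list_act int (eval W * cen (~~ i) / eval W) [::] =
    W ++ shift (~~ i) 1%R (normal_form (eval W)^-1).
  rewrite (list_actM _ _ (_ * _)) // (list_actM _ _ (eval W)) ?reduced_act //.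
  by rewrite act_cen ?reduced_act // act_eval embed_int.
have := congr1 (fun g => list_act int g [::]) cc.
rewrite /= (list_actM _ _ (cen i)) // (list_actM _ _ (_ / _)) //.
rewrite [list_act int (cen i) [::]]act_cen //= E act_cen //.
rewrite /=; case: (i) => -[/eqP]; rewrite -subr_eq0 addrC addKr oner_eq0 //.
Qed.

End Conjugacy.

(** * Rigidity of the pair of generators *)

Section Rigidity.
Variables m n : nat.
Hypotheses (m_gt1 : 1 < m) (n_gt1 : 1 < n).
Notation expo := (expo m n).
Notation gen := (gen m n).
Notation cen := (cen m n).
Notation letter := (bool * int * nat)%type.
Notation list_act := (list_act m_gt1 n_gt1).
Notation eval := (eval m n).
Notation normal_form := (normal_form m_gt1 n_gt1).
Implicit Types (g h k z : Gmn m n) (i j : bool) (w : seq letter).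

(** A letter of the other type would have its exponent increased by 1. *)
Lemma shift_fix i w : shift i (1%R : int) w = w -> all (fun l => l.1.1 == i) w.
Proof.
elim: w => //= -[[j p] s] w IH; case: eqVneq => /= [_ [/IH]|_ [/eqP]] //.
by rewrite -subr_eq0 addrC addKr oner_eq0.
Qed.

Lemma commute_cen_form i g : commute (cen i) g ->
  exists w k, [/\ in_core k, reduced m n w, all (fun l => l.1.1 == i) w
                & g = eval w * k].
Proof.
move=> cg; have [k kK Dg] := eval_normal_form m_gt1 n_gt1 g.
have rw := reduced_normal_form m_gt1 n_gt1 g.
exists (normal_form g), k; split=> //; apply: shift_fix.
have := congr1 (fun h => list_act int h [::]) cg.
rewrite /= (list_actM _ _ (cen i)) // (list_actM _ _ g) //.
by rewrite [list_act int (cen i) [::]]act_cen // act_cen.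
Qed.

(** A product d^p1 a^s1 ... d^pr a^sr with no zero exponent: the part of an
  element of the centraliser of c on which the conjugate of a depends, apart
  from a final power of d. *)
Definition ladder i w :=
  all (fun l => [&& l.1.1 == i, l.1.2 != 0%R & 0 < l.2 < expo i]) w.

Lemma reduced_ladder i l w : reduced m n (l :: w) ->
  all (fun l => l.1.1 == i) (l :: w) -> ladder i w.
Proof.
elim: w l => [//|[[j p] s] w IH] [[j' p'] s'] rw /= /andP[/eqP Dj' al].
have [_ fw rw'] := and3P rw; move: fw (rw') => /= + /and3P[sM _ _].
have /andP[/eqP /= Dj _] := al; rewrite {}Dj' {}Dj in al rw' sM *.
by rewrite !eqxx /= => ->; rewrite sM; exact: (IH (i, p, s)).
Qed.

(** An initial power of a and all powers of c commute with a, hence can be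
  dropped from [g]. *)
Lemma conj_gen_form i g : commute (cen i) g ->
  exists w v, ladder i w /\
    gen i ^ g = gen i ^ (eval w * zpow (cen (~~ i)) v).
Proof.
move=> /commute_cen_form[w [k [/(in_coreP i)[u [v ->]] rw aw ->]]].
have [w' [lw' Dw']] : exists w', ladder i w' /\
    forall z, gen i ^ (eval w * z) = gen i ^ (eval w' * z).
  case: w rw aw => [|[[j p] s] w] rw aw; first by exists [::].
  have lw := reduced_ladder rw aw.
  have /andP[/eqP /= Dj _] := aw; have /and3P[sM _ _] := rw; rewrite {}Dj in sM *.
  have [->|p0] := eqVneq p 0%R; last first.
    by exists ((i, p, s) :: w); rewrite /= eqxx p0 sM.
  exists w; split=> // z.
  have El : letter_elt m n (i, 0%R, s) = gen i ^+ s by exact: mul1g.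
  rewrite [eval _]/= El -mulgA (conjgM _ (gen i ^+ s)).
  by rewrite (@conjg_commute _ _ (gen i ^+ s)) //; apply: commuteX.
exists w', v; split=> //; rewrite -Dw' mulgA.
rewrite (_ : eval w * zpow _ u = zpow (cen i) u * eval w); last first.
  by apply/zpow_commute/commute_sym/eval_commute.
rewrite -mulgA (conjgM _ (zpow (cen i) u)) (@conjg_commute _ _ (zpow (cen i) u)) //.
exact/zpow_commute/gen_commute_cen.
Qed.

(** An endomorphism that maps each generator x to the conjugate of x or x^-1 by a
  ladder replaces each letter by a longer product, and no merging takes place
  between these products. *)
Section Counting.
Variables (W : bool -> seq letter) (eps : bool) (psi : Gmn m n -> Gmn m n).
Let sg : int := ((-1) ^+ eps)%R.
Hypothesis ladderW : forall i, ladder i (W i).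
Hypothesis psiM : {morph psi : g h / g * h}.
Hypothesis psi_gen : forall i, psi (gen i) = zpow (gen i) sg ^ eval (W i).

Lemma psi_cen i : psi (cen i) = zpow (cen i) sg.
Proof.
rewrite -[cen i]/(zpow (gen i) (expo i)) (morph_zpow psiM) psi_gen -zpowJ.
rewrite zpowM mulrC -zpowM.
apply: conjg_commute; apply/commute_sym/zpow_commute/commute_sym/eval_commute.
by apply: sub_all (ladderW i) => l /and3P[].
Qed.

Lemma psi_core k : in_core k -> in_core (psi k).
Proof.
move=> [u [v ->]]; rewrite psiM !(morph_zpow psiM) !psi_cen.
by exists (sg * u)%R, (sg * v)%R; rewrite !zpowM.
Qed.

Lemma reduced_ladder_cat i w (v : seq letter) :
  ladder i w -> fresh i v -> reduced m n v ->
  reduced m n (w ++ v) /\ fresh i (w ++ v).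
Proof.
move=> + fv rv; elim: w => [//|[[j p] s] w IH] /= /andP[/and3P[/= /eqP-> p0 sM]].
by move=> /IH[rw fw]; rewrite sM fw rw p0 orbT.
Qed.

(** No letters merge, because the exponents p of a ladder are nonzero. *)
Lemma act_ladderV i w (v : seq letter) :
    ladder i w -> fresh i v = false -> reduced m n v ->
  let v' := list_act int (eval w)^-1 v in
  [/\ reduced m n v', fresh i v' = false & forall j,
      count_type j v' = ((i == j) * size w + count_type j v)%N].
Proof.
move=> lw fv rv /=; elim: w v lw fv rv => [|[[j p] s] w IH] v /=.
  by move=> _ fv rv; rewrite invg1 list_act1 //; split=> // j; rewrite muln0.
case/andP=> /and3P[/= /eqP-> p0 sM] lw fv rv.
have fw1 : fresh i (shift (~~ i) (- p)%R v).
  have [t [v' ->]] := unfresh fv.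
  by case: (i) => /=; rewrite add0r oppr_eq0 p0.
rewrite invgM list_actM // act_letterV //.
set v1 := _ :: _.
have rv1 : reduced m n v1 by rewrite /v1 -act_letterV // reduced_act.
have [|r f c] := IH v1 lw _ rv1; first by rewrite /= !eqxx.
split=> // k; rewrite c /= -/(count_type k _) !count_shift.
by rewrite mulnS; lia.
Qed.

Lemma act_gen_sign j s (v : seq letter) :
    0 < s < expo j -> fresh j v -> reduced m n v ->
  let v' := list_act int (zpow (gen j) (sg * s%:Z)%R) v in
  [/\ reduced m n v', fresh j v' = false & forall i,
      count_type i v' = ((j == i) + count_type i v)%N].
Proof.
move=> sM fv rv /=; split; first exact: reduced_act.
- rewrite /sg; case: eps; last by rewrite mul1r list_act_genX // turn_fresh //= !eqxx.
  have El : letter_elt m n (j, 0%R, s) = gen j ^+ s by exact: mul1g.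
  rewrite mulN1r zpowN -[zpow _ _]El act_letterV ?oppr0 ?shift0 //.
  by rewrite /= !eqxx.
- move=> i; rewrite /sg; case: eps; last first.
    by rewrite mul1r list_act_genX // turn_fresh.
  have El : letter_elt m n (j, 0%R, s) = gen j ^+ s by exact: mul1g.
  rewrite mulN1r zpowN -[zpow _ _]El act_letterV ?oppr0 ?shift0 //.
  by rewrite /= -/(count_type i _) count_shift.
Qed.

(** A letter of type [i] becomes a power of [cen (~~ i)] times E^-1 x^(+-s) E,
  where x = [gen i] and E is a ladder with size (W i) letters: E^-1 contributes as
  many letters as E, and x^(+-s) one more. Freshness is carried along since the
  first exponent p only changes by a sign. *)
Lemma count_psi w : reduced m n w ->
  let v := list_act int (psi (eval w)) [::] in
  (forall i, fresh i w -> fresh i v) /\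
  (forall i, count_type i v = ((size (W i)).*2.+1 * count_type i w)%N).
Proof.
elim: w => [_|[[j p] s] w IH] /=.
  by rewrite (morph_one psiM) list_act1 //; split=> // i; rewrite muln0.
case/and3P=> sM fw rw; have [fv cv] := IH rw.
rewrite psiM list_actM //; move: fv cv.
have : reduced m n (list_act int (psi (eval w)) [::]) by apply: reduced_act.
move: (list_act int (psi (eval w)) [::]) => v rv fv cv.
have [r1 f1] := reduced_ladder_cat (ladderW j) (fv _ fw) rv.
have [/= r2 f2 c2] := act_gen_sign sM f1 r1.
have [/= r3 f3 c3] := act_ladderV (ladderW j) f2 r2.
have -> : list_act int (psi (letter_elt m n (j, p, s))) v =
    shift (~~ j) (sg * p)%R (list_act int (eval (W j))^-1
       (list_act int (zpow (gen j) (sg * s%:Z)%R) (W j ++ v))).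
  rewrite /letter_elt psiM (morph_zpow psiM) psi_cen zpowM list_actM //.
  rewrite -[gen _ ^+ _]/(zpow (gen j) s) (morph_zpow psiM) psi_gen -zpowJ zpowM.
  rewrite act_zcen ?reduced_act // intz; congr shift.
  rewrite conjgE list_actM // list_actM // act_eval embed_int //.
split=> i.
  have [t [v3 ->]] := unfresh f3; rewrite /=.
  by case: (j) => /=; rewrite add0r mulf_eq0 signr_eq0.
rewrite count_shift c3 c2 /count_type count_cat.
rewrite -!/(count_type i _) cv.
have -> : count_type i (W j) = ((j == i) * size (W j))%N.
  elim: (W j) (ladderW j) => [|l u IHu] /=; first by rewrite muln0.
  by case/andP=> /and3P[/eqP-> _ _] /IHu; rewrite /count_type => ->; rewrite mulnS.
case: eqVneq => [->|_] //=; lia.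
Qed.

(** The generator has one letter, and 1 is a multiple of an odd number 2r + 1
  only for r = 0. *)
Lemma psi_surj_ladder i : (exists g, psi g = gen i) -> W i = [::].
Proof.
move=> [g Dg]; have [k kK Dgk] := eval_normal_form m_gt1 n_gt1 g.
have [_ /(_ i)] := count_psi (reduced_normal_form m_gt1 n_gt1 g).
have -> : list_act int (psi (eval (normal_form g))) [::] = [:: (i, 0%R, 1%N)].
  rewrite -[X in list_act _ _ X](act_core m_gt1 n_gt1 int (psi_core kK)).
  by rewrite -list_actM // -psiM -Dgk Dg list_act_gen.
rewrite /count_type /= eqxx; case: (W i) => //= l w.
by case: (count _ _) => [|c]; rewrite ?muln0 // doubleS mulnS.
Qed.

End Counting.

End Rigidity.

(** * Normal automorphisms *)

(** A modulus larger than all the exponents. *)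
Lemma modulus_exists (w : seq (bool * int * nat)) : exists2 N, 1 < N &
  {in w, forall l, l.1.2%:~R = 0 :> 'Z_N -> l.1.2 = 0}%R.
Proof.
have [N N1 bN] : exists2 N, 1 < N & {in w, forall l, `|l.1.2| < N}.
  elim: w => [|l w [N N1 bN]]; first by exists 2.
  exists (`|l.1.2| + N).+1; first by lia.
  move=> l'; rewrite inE => /predU1P[->|/bN lN]; first by rewrite ltnS leq_addr.
  by rewrite ltnS (leq_trans (ltnW lN)) ?leq_addl.
exists N => // l /bN; case: l => [[i p] s] /= {i s}.
have nat0 q : q < N -> (q%:R = 0 :> 'Z_N)%R -> q = 0.
  by move=> qN /(congr1 val); rewrite /= val_Zp_nat // modn_small.
case: p => q; first by move=> qN /nat0->.
by rewrite NegzE mulrNz => qN /eqP; rewrite oppr_eq0 => /eqP/nat0->.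
Qed.

Lemma reduced_embed (m n : nat) (R : nzRingType) (w : seq (bool * int * nat)) :
    {in w, forall l, l.1.2%:~R = 0 :> R -> l.1.2 = 0}%R ->
  reduced m n w -> reduced m n (embed R w).
Proof.
elim: w => [//|[[i p] s] w IH] inj /= /and3P[-> fw rw].
rewrite IH // => [|l lw]; last by apply: inj; rewrite inE lw orbT.
case: w fw inj {IH rw} => //= -[[j q] t] w /orP[->//|q0] inj.
rewrite andbT; apply/orP; right; apply: contra q0 => /eqP q0.
by apply/eqP/(inj (j, q, t)); rewrite // !inE eqxx orbT.
Qed.

Section NormalAutomorphism.
Variables m n : nat.
Notation expo := (expo m n).
Notation gen := (gen m n).
Notation cen := (cen m n).
Notation letter := (bool * int * nat)%type.
Notation eval := (eval m n).
Notation exponent := (@exponent m n).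

Variable phi : {multiplicative Gmn m n -> Gmn m n}.
Hypothesis phi_normal : normal_automorphism phi.

Lemma phi_stable N g : normal_subgroup N -> N g -> N (phi g).
Proof. by move=> nN Ng; rewrite -(phi_normal.2 _ nN); exists g. Qed.

Lemma phi_surj h : exists g, phi g = h.
Proof. by have [f _ fK] := phi_normal.1; exists (f h). Qed.

Let phiM : {morph phi : g h / g * h} := gmulfM.

Lemma exponent_kernel_normal (r s : int) :
  normal_subgroup [set g | r * exponent true g + s * exponent false g = 0]%R%classic.
Proof.
split=> /= [|x y Nx Ny|x Nx|x g Nx].
- by rewrite !exponent1 !mulr0.
- by rewrite !exponentM !mulrDr addrACA Nx Ny.
- by rewrite !exponentV !mulrN -opprD Nx oppr0.
- by rewrite !exponentJ.
Qed.

(** The kernels of the two exponent sums and of their sum contain b, a and a b^-1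
  respectively; this makes the action of [phi] on the abelianisation scalar, and
  the scalar divides 1 since [phi] is onto. *)
Lemma exponent_phi : exists eps : bool, forall i g,
  (exponent i (phi g) = (-1) ^+ eps * exponent i g)%R.
Proof.
pose k := exponent true (phi (gen true)).
have k_gen i j : exponent i (phi (gen j)) = (k * exponent i (gen j))%R.
  have := phi_stable (exponent_kernel_normal 1 0) (g := gen false).
  have := phi_stable (exponent_kernel_normal 0 1) (g := gen true).
  have := phi_stable (exponent_kernel_normal 1 1) (g := gen true / gen false).
  rewrite /= phiM (morph_inv phiM) !exponentM !exponentV !exponent_gen /= -/k.
  move=> /(_ erefl) + /(_ erefl) + /(_ erefl).
  by case: i; case: j; rewrite /= -/k; lia.
have k_all i g : exponent i (phi g) = (k * exponent i g)%R.
  elim/Gmn_ind: g => [|j g IH|j g IH].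
  - by rewrite (morph_one phiM) exponent1 mulr0.
  - by rewrite phiM !exponentM IH k_gen mulrDr.
  - by rewrite phiM (morph_inv phiM) !exponentM !exponentV IH k_gen mulrDr mulrN.
have [g /(congr1 (exponent true))] := phi_surj (gen true).
rewrite k_all exponent_gen /= => kg.
have k1 : `|k|%N = 1%N.
  apply/eqP; have := congr1 absz kg; rewrite abszM => /eqP.
  by rewrite muln_eq1 => /andP[].
by exists (k < 0)%R => i h; rewrite k_all [k in LHS]intEsign k1 mulr1.
Qed.

Hypotheses (m_gt1 : 1 < m) (n_gt1 : 1 < n).
Notation list_act := (list_act m_gt1 n_gt1).
Variable eps : bool.
Let sg : int := ((-1) ^+ eps)%R.
Hypothesis exponentE : forall i g, exponent i (phi g) = (sg * exponent i g)%R.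

(** The kernel of the action with exponents modulo N contains a power of [gen i],
  so it contains a power of its image; if the image were conjugate to a
  cyclically reduced product, that power would be a nonempty reduced product, and
  remain so modulo a large enough N. *)
Lemma phi_gen i : exists g, phi (gen i) = zpow (gen i) sg ^ g.
Proof.
have [h Ch] := conj_form_exists m_gt1 n_gt1 (phi (gen i)).
have ei : exponent i (phi (gen i) ^ h) = sg.
  by rewrite exponentJ exponentE exponent_gen eqxx mulr1.
case: Ch ei => [Kg|j p Dg|w z Dg w0 rw cw zK wz] ei.
- have [u [v Dg]] := proj1 (in_coreP i _) Kg; exfalso; move: ei.
  have e1 := expo_gt1 m_gt1 n_gt1 i.
  rewrite Dg exponentM !exponent_zpow !exponent_cen eqxx.
  have -> : (~~ i == i) = false by case: (i).
  have s1 : `|sg|%N = 1%N by rewrite /sg; case: eps.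
  move/(congr1 absz); rewrite mul0n mul0r addr0 mul1n abszM s1 => /eqP.
  by rewrite muln_eq1 /= => /andP[/eqP ee _]; rewrite ee in e1.
- have Dj : j = i.
    apply/eqP; apply: contraT => ji; move: ei; rewrite Dg exponent_zpow exponent_gen.
    by rewrite (negPf ji) mul0r /sg; case: eps.
  subst j; move: ei; rewrite Dg exponent_zpow exponent_gen eqxx mul1r => Dp.
  by exists h^-1; rewrite -Dp -Dg conjgK.
exfalso; have [N N1 inj] := modulus_exists w.
pose K := kernel (list_action m_gt1 n_gt1 'Z_N).
have nK : normal_subgroup K by apply: kernel_normal.
have Kg : K (gen i ^+ (expo i * N)).
  move=> v /= rv; rewrite expgnA -/(list_act 'Z_N _ _) act_cenX //.
  by rewrite pchar_Zp // shift0.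
have Kw : K ((eval w * z) ^+ (expo i * N)).
  rewrite -Dg -conjXg; apply: (normal_subgroupJ nK).
  rewrite -[_ ^+ _]/(zpow (phi (gen i)) (expo i * N)%N) -(morph_zpow phiM).
  exact: (phi_stable nK Kg).
have := Kw [::] erefl; rewrite -/(list_act 'Z_N _ _) expgMn // list_actM //.
have zX : in_core (z ^+ (expo i * N)).
  by elim: (expo i * N)%N => [|k IH]; [exact: in_core1|rewrite expgS; exact: in_coreM].
rewrite act_core // -eval_power.
have e0 : (0 < expo i * N)%N.
  by rewrite muln_gt0 (ltnW N1) (ltnW (expo_gt1 m_gt1 n_gt1 i)).
have rX : reduced m n (embed 'Z_N (flatten (nseq (expo i * N)%N w))).
  apply: reduced_embed (reduced_power _ rw cw) => l /flattenP[w'].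
  by rewrite mem_nseq => /andP[_ /eqP->]; exact: inj.
have := act_eval m_gt1 n_gt1 (R := 'Z_N)
  (u := flatten (nseq (expo i * N)%N w)) (w := [::]).
rewrite cats0 => /(_ rX) ->; move: e0; case: (expo i * N)%N => //= k _.
by case: (w) w0.
Qed.

Lemma zpow_sign_commute (g h : Gmn m n) : commute (zpow g sg) h -> commute g h.
Proof.
rewrite /sg; case: eps => //= gh; rewrite -[g]invgK.
exact: commuteV2.
Qed.

(** The two conjugating elements are adjusted to a common one by
  [commute_cen_conj]; the ladders left over are trivial since [phi] is onto. *)
Lemma phi_standard : exists t, forall i, phi (gen i) = zpow (gen i) sg ^ t.
Proof.
have [g1 Dg1] := phi_gen true; have [g2 Dg2] := phi_gen false.
have phi_cen i g : phi (gen i) = zpow (gen i) sg ^ g ->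
    phi (cen i) = zpow (cen i ^ g) sg.
  move=> Dg; rewrite -[cen i]/(zpow (gen i) (expo i)) (morph_zpow phiM) Dg.
  by rewrite -!zpowJ !zpowM mulrC.
have [x [y [Dxy cx cy]]] : exists x y, [/\ g1 / g2 = x * y,
    commute (cen true) x & commute (cen (~~ true)) y].
  apply: (commute_cen_conj m_gt1 n_gt1).
  have := cen_commute m n true false.
  move/(congr1 phi); rewrite !phiM (phi_cen _ _ Dg1) (phi_cen _ _ Dg2).
  move/zpow_sign_commute/commute_sym/zpow_sign_commute/commute_sym.
  move=> c12; apply: (conjg_inj g1).
  have J : (cen false ^ g2) = (g1 / g2 * cen (~~ true) / (g1 / g2)) ^ g1.
    by rewrite !conjgE invgF !mulgA mulVg mul1g mulgVK.
  by rewrite [LHS]conjMg [RHS]conjMg -J.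
have [w1 [v1 [lw1 E1]]] := conj_gen_form m_gt1 n_gt1 cx.
have [w2 [v2 [lw2 E2]]] := conj_gen_form m_gt1 n_gt1 (commuteV cy).
set s := y * g2.
have Dg1' : g1 = x * s by rewrite /s mulgA -Dxy mulgVK.
have Dg2' : g2 = y^-1 * s by rewrite /s mulKg.
(* In front of s, the power of [cen (~~ i)] required for [gen i] is completed by
   the power of [cen i] required for the other generator: it has no effect on
   [gen i]. *)
pose t := zpow (cen true) v2 * (zpow (cen false) v1 * s).
pose W (i : bool) := if i then w1 else w2.
have lW i : ladder m n i (W i) by case: i.
have absorb i r z : zpow (gen i) sg ^ (eval (W i) * (zpow (cen i) r * z)) =
                    zpow (gen i) sg ^ (eval (W i) * z).
  have ce : commute (eval (W i)) (zpow (cen i) r).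
    apply/zpow_commute/commute_sym/eval_commute.
    by apply: sub_all (lW i) => l /and3P[].
  rewrite mulgA ce -mulgA (conjgM _ (zpow (cen i) r)).
  rewrite (@conjg_commute _ _ (zpow (cen i) r)) //.
  by apply/commute_sym/zpow_commute/commute_sym/zpow_commute/gen_commute_cen.
have phi_t i : phi (gen i) = zpow (gen i) sg ^ (eval (W i) * t).
  case: i.
    rewrite absorb Dg1 Dg1' (conjgM _ x) (zpowJ _ x) E1 -zpowJ -conjgM.
    by rewrite -mulgA.
  have -> : t = zpow (cen false) v1 * (zpow (cen true) v2 * s).
    by rewrite /t !mulgA (@zcen_commute m n true false).
  rewrite absorb Dg2 Dg2' (conjgM _ y^-1) (zpowJ _ y^-1) E2 -zpowJ -conjgM.
  by rewrite -mulgA.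
pose psi g := phi g ^ t^-1.
have psiM : {morph psi : g h / g * h} by move=> g h; rewrite /psi phiM conjMg.
have psi_gen i : psi (gen i) = zpow (gen i) sg ^ eval (W i).
  by rewrite /psi phi_t conjgM conjgK.
have psi_s i : exists g, psi g = gen i.
  by have [g Dg] := phi_surj (gen i ^ t); exists g; rewrite /psi Dg conjgK.
exists t => i; rewrite phi_t.
by rewrite (psi_surj_ladder m_gt1 n_gt1 lW psiM psi_gen (psi_s i)) mul1g.
Qed.

End NormalAutomorphism.

(** * A chiral quotient *)

Section Chirality.
Variables (m n : nat) (R : comNzRingType).
Hypothesis n0 : (n%:R = 0 :> R)%R.

(** On R[X]/(X^3 + X + 1) with basis 1, X, X^2, the generator a acts as
  multiplication by X and b as translation by 1, of order dividing n. *)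
Definition chiral_move (i : bool) (t : R * R * R) : R * R * R :=
  let: (x, y, z) := t in if i then (- z, x - z, y)%R else (x + 1, y, z)%R.

Definition chiral_back (i : bool) (t : R * R * R) : R * R * R :=
  let: (x, y, z) := t in if i then (y - x, z, - x)%R else (x - 1, y, z)%R.

Lemma chiral_moveK i t : chiral_back i (chiral_move i t) = t.
Proof. by case: t i => [[x y] z] [] /=; congr (_, _, _); ring. Qed.

Lemma chiral_backK i t : chiral_move i (chiral_back i t) = t.
Proof. by case: t i => [[x y] z] [] /=; congr (_, _, _); ring. Qed.

Lemma chiral_move_order t : iter n (chiral_move false) t = t.
Proof.
have E k x y z : iter k (chiral_move false) (x, y, z) = ((x + k%:R)%R, y, z).
  by elim: k => [|k /= ->]; rewrite ?addr0 //= -addrA natr1.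
by case: t => [[x y] z]; rewrite E n0 addr0.
Qed.

Lemma chiral_comm t : True ->
  iter m (chiral_move true) (iter n (chiral_move false) t) =
  iter n (chiral_move false) (iter m (chiral_move true) t).
Proof. by rewrite !chiral_move_order. Qed.

Definition chiral_action : action m n (R * R * R) :=
  @Action m n (R * R * R) (fun=> True) chiral_move chiral_back
    (fun _ _ _ => I) (fun _ _ _ => I)
    (fun i t _ => chiral_moveK i t) (fun i t _ => chiral_backK i t) chiral_comm.

(** The product of a^3 b a^-3, a b a^-1 and b, which act as the translations by
  X^3, X and 1. *)
Definition chiral_elt (a b : Gmn m n) :=
  a * (a * (a * (b * (a^-1 * (a^-1 * (b * (a^-1 * b))))))).

Lemma chiral_elt_kernel :
  kernel chiral_action (chiral_elt (gen m n true) (gen m n false)).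
Proof.
move=> [[x y] z] _; rewrite /chiral_elt !(actM, act_gen, act_genV) //=.
by congr (_, _, _); ring.
Qed.

(** With a and b inverted, the translation is by the opposite of X^-3 + X^-1 + 1,
  which equals X^-3 (X^2 - X). *)
Lemma chiral_elt_inv_kernel :
  ~ kernel chiral_action (chiral_elt (gen m n true)^-1 (gen m n false)^-1).
Proof.
move/(_ (0, 0, 0)%R I); rewrite /chiral_elt !invgK.
rewrite !(actM, act_gen, act_genV) //= => -[_ y0 _].
suff: (- 1 == 0 :> R)%R by rewrite oppr_eq0 oner_eq0.
by apply/eqP; ring: y0.
Qed.

End Chirality.

Theorem theorem2 (m n : nat) (m_gt1 : 1 < m) (n_gt1 : 1 < n)
    (phi : {multiplicative Gmn m n -> Gmn m n}) :
  normal_automorphism phi -> inner_automorphism phi.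
Proof.
move=> phi_normal; have [eps Ephi] := exponent_phi phi_normal.
have [t Dphi] := phi_standard phi_normal m_gt1 n_gt1 Ephi.
have phiM : {morph phi : g h / g * h} := gmulfM.
case: eps Ephi Dphi => _ Dphi.
  exfalso; have n0 := pchar_Zp n_gt1.
  have nK := kernel_normal (chiral_action m n0).
  apply: (@chiral_elt_inv_kernel m n _ n0).
  have := normal_subgroupJ nK t^-1
    (phi_stable phi_normal nK (@chiral_elt_kernel m n _ n0)).
  rewrite /chiral_elt !(phiM, morph_inv phiM) !Dphi.
  by rewrite -!(conjMg, conjVg) conjgK.
exists t; elim/Gmn_ind=> [|i g IH|i g IH].
- by rewrite (morph_one phiM) conj1g.
- by rewrite phiM IH Dphi conjMg.
- by rewrite phiM IH (morph_inv phiM) Dphi conjMg conjVg.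
Qed.
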